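(* There is a deterministic online algorithm for the Multi-Level Aggregation Problem with deadlines (MLAP-deadline) that is $D$-competitive on arbitrary weighted rooted trees of depth $D$. That is, for every finite rooted tree $\mathcal{T}$ of depth $D$ with arbitrary vertex weights $w(v)\ge 0$ and every finite set $\mathcal{J}$ of requests with deadlines, the algorithm produces online a feasible solution whose cost satisfies $\mathrm{ALG}(\mathcal{T},\mathcal{J})\le D\cdot \mathrm{OPT}(\mathcal{T},\mathcal{J})$.
   Context: MLAP. An instance consists of a finite tree $\mathcal{T}$ rooted at $r$ with vertex weights $w(v)\ge 0$ and a finite set $\mathcal{J}$ of requests. Request $j$ arrives at a node $v_j$ at time $a_j$. A service $(T,t)$ transmits a subtree $T$ of $\mathcal{T}$ containing $r$ at time $t$, with cost $w(T)=\sum_{v\in T}w(v)$. A solution is a sequence of services $(T_1,t_1),(T_2,t_2),\dots$. Request $j$ is served at the first time $\mathrm{served}(j)\ge a_j$ at which the transmitted subtree contains $v_j$. The depth $D$ is the number of vertices on a longest root-to-leaf path. MLAP-deadline. Each request $j$ also has a deadline $d_j\ge a_j$; a solution is feasible if $\mathrm{served}(j)\in[a_j,d_j]$ for all $j\in\mathcal{J}$. Its cost is $\sum_i w(T_i)$. All times are integers (without loss of generality). Online model. The tree $\mathcal{T}$ (with weights) is known in advance; request $j$ and its attributes (location, deadline) are revealed at time $a_j$. The services transmitted by the online algorithm up to time $t$ depend only on $\mathcal{T}$ and on the requests with $a_j\le t$. $\mathrm{OPT}(\mathcal{T},\mathcal{J})$ is the minimum cost of a feasible solution when $\mathcal{T}$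 and $\mathcal{J}$ are known upfront, and $\mathrm{ALG}(\mathcal{T},\mathcal{J})$ is the cost of the online algorithm's solution. *)

(* Defs.v *)
From HB Require Import structures.
From mathcomp Require Import all_boot all_order all_algebra.

Set Implicit Arguments.
Unset Strict Implicit.
Unset Printing Implicit Defensive.

Import Order.TTheory GRing.Theory Num.Theory.
Local Open Scope ring_scope.

(* The root is its own parent by convention; this loop is not an edge. *)
Record wtree (R : realFieldType) := WTree {
  vertex :> finType;
  root : vertex;
  parent : vertex -> vertex;
  weight : vertex -> R;
  parent_root : parent root = root;
  root_reachable : forall v, fconnect parent v root;
  weight_ge0 : forall v, 0 <= weight v
}.

Arguments root {R w}.
Arguments parent {R w}.
Arguments weight {R w}.

Section MLAP.
Variables (R : realFieldType) (T : wtree R).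

Definition child (v u : T) : bool := (u != root) && (parent u == v).

Definition adjacent (u v : T) : bool := child u v || child v u.

Definition leaf (v : T) : bool := [forall u, ~~ child v u].

(* The vertices of the path between v and the root: the orbit of v under
   [parent], which ends with the fixed point [root]. *)
Definition root_path (v : T) : {set T} := [set u | fconnect parent v u].

Definition depth : nat := \max_(v : T | leaf v) #|root_path v|.

(* A subtree is identified with its vertex set. *)
Definition connected (X : {set T}) : Prop :=
  {in X &, forall u v,
    connect [rel x y | [&& x \in X, y \in X & adjacent x y]] u v}.

Definition rooted_subtree (X : {set T}) : Prop := root \in X /\ connected X.

(* (location, arrival time, deadline) *)
Definition request : Type := (T * int * int)%type.
Definition location (j : request) : T := j.1.1.
Definition arrival (j : request) : int := j.1.2.
Definition deadline (j : request) : int := j.2.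

(* Finite collections of requests are sequences, so that distinct requests may
   share all their attributes; their order is irrelevant (see [online]). *)
Definition request_set (J : seq request) : Prop :=
  {in J, forall j, arrival j <= deadline j}.

(* (transmitted vertex set, transmission time) *)
Definition service : Type := ({set T} * int)%type.
Definition transmitted (s : service) : {set T} := s.1.
Definition time (s : service) : int := s.2.

Definition solution (S : seq service) : Prop :=
  {in S, forall s, rooted_subtree (transmitted s)}.

Definition cost (S : seq service) : R :=
  \sum_(s <- S) \sum_(v in transmitted s) weight v.

(* [served S j t]: the first time at or after the arrival of j at which S
   transmits the location of j exists and is t. *)
Definition served (S : seq service) (j : request) (t : int) : Prop :=
  [/\ arrival j <= t,
      exists2 s, s \in S & location j \in transmitted s /\ time s = t
    & {in S, forall s, location j \in transmitted s ->
        arrival j <= time s -> t <= time s}].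

Definition feasible (J : seq request) (S : seq service) : Prop :=
  solution S /\
  {in J, forall j, exists2 t, served S j t & arrival j <= t <= deadline j}.

Definition is_OPT (J : seq request) (c : R) : Prop :=
  (exists2 S, feasible J S & cost S = c) /\
  (forall S, feasible J S -> c <= cost S).

Definition arrived_by (t : int) (J : seq request) : seq request :=
  [seq j <- J | arrival j <= t].

Definition services_until (t : int) (S : seq service) : seq service :=
  [seq s <- S | time s <= t].

End MLAP.

Definition algorithm (R : realFieldType) : Type :=
  forall T : wtree R, seq (request T) -> seq (service T).

Definition online (R : realFieldType) (A : algorithm R) : Prop :=
  forall (T : wtree R) (J J' : seq (request T)) (t : int),
    request_set J -> request_set J' ->
    perm_eq (arrived_by t J) (arrived_by t J') ->
    services_until t (A T J) = services_until t (A T J').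

(* Main.v *)
(* The algorithm serves at time t only if an unserved request is due at t. It
   starts from the paths joining the root to the locations of due requests;
   every transmitted vertex v then gets a budget w(v), spent on the most urgent
   unserved requests below v by paying for the missing vertices on their paths.
   A vertex that has been paid in full is transmitted; partial payments are
   kept as credit until its next transmission.

   Fix a feasible solution S. At time t, call v overdue if some unserved request
   below v has its deadline before the next transmission of v by S. Transmissions
   of v by the algorithm are early (v not overdue), pending (v overdue and still
   so afterwards) or critical. S transmits v at least once per critical
   transmission of v. The budget of a pending transmission is spent entirely, and
   only on overdue vertices, so its cost can be charged downwards to what it pays
   for, while an early transmission was paid in full by its investors and can be
   charged upwards to them. As payments strictly increase the level, a critical
   transmission of v at level l receives at most (l - 1) w(v) from pending and
   (D - l) w(v) from early ones, hence D w(v) with its own cost. The charging is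
   carried out by a potential: a unit of credit on v is worth l - 1 if v is overdue
   and l - 1 - D otherwise. *)
Require Import Defs.
From mathcomp Require Import all_boot all_order all_algebra.
From mathcomp Require Import ring lra zify.
From Stdlib Require Import Classical.

Set Implicit Arguments.
Unset Strict Implicit.
Unset Printing Implicit Defensive.

Import Order.TTheory GRing.Theory Num.Theory.
Local Open Scope ring_scope.

(* [poly.root] would otherwise shadow the root of a tree. *)
Local Notation root := Defs.root.

(** * Ancestors and rooted subtrees *)

Section Tree.
Variables (R : realFieldType) (T : wtree R).
Implicit Types (u v z : T) (X : {set T}).

Definition anc v u : bool := fconnect parent u v.
Definition level v : nat := #|root_path v|.
Definition parent_closed X : Prop := {in X, forall u, parent u \in X}.

Lemma anc_refl v : anc v v.
Proof. exact: connect0. Qed.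

Lemma anc_trans u v z : anc v u -> anc u z -> anc v z.
Proof. by move=> vu uz; apply: connect_trans uz vu. Qed.

Lemma anc_parent u : anc (parent u) u.
Proof. exact: fconnect1. Qed.

Lemma anc_root u : anc root u.
Proof. exact: root_reachable. Qed.

Lemma iter_parent_root n : iter n parent (root : T) = root.
Proof. by elim: n => //= n ->; rewrite parent_root. Qed.

(** Enough rounds of the cycle climb at least to [root], a fixed point of [parent], and yet end at
    [u]. *)
Lemma iter_parent_cycle u n : iter n.+1 parent u = u -> u = root.
Proof.
move=> cyc; have /iter_findex := root_reachable u.
set k := findex _ _ _ => kE.
have mulE m : iter (m * n.+1)%N parent u = u.
  by elim: m => [|m IH]; rewrite ?mul0n // mulSn iterD IH.
by rewrite -(mulE k) mulnS addnC iterD kE iter_parent_root.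
Qed.

Lemma anc_antisym u v : anc u v -> anc v u -> u = v.
Proof.
move=> /iter_findex; set m := findex _ _ _ => mE.
move=> /iter_findex; set n := findex _ _ _ => nE.
case: m mE => [|m] mE //; have /iter_parent_cycle vE : iter (m + n)%N.+1 parent v = v.
  by rewrite -addSn addnC iterD mE nE.
by rewrite -mE vE iter_parent_root.
Qed.

Lemma level_gt0 v : (0 < level v)%N.
Proof. by apply/card_gt0P; exists v; rewrite inE connect0. Qed.

Lemma level_anc_lt u v : anc v u -> u != v -> (level v < level u)%N.
Proof.
move=> vu neq; apply/proper_card/properP; split.
  by apply/subsetP => z; rewrite !inE; apply: connect_trans.
exists u; rewrite inE ?connect0 //.
by apply: contra neq => uv; apply/eqP/anc_antisym.
Qed.

Lemma level_le_depth v : (level v <= depth T)%N.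
Proof.
(* [depth] ranges over leaves only; a deepest vertex below [v] is a leaf, since a child of it would
   be deeper. *)
have [u vu umax] := @arg_maxnP T v (anc v) level (anc_refl v).
apply: leq_trans (umax v (anc_refl v)) _.
rewrite /depth (bigD1 u) /= ?leq_maxl //.
apply/forallP => z; apply/negP => /andP[zr /eqP pz].
have uz : anc u z by rewrite -pz anc_parent.
have /= := umax z (anc_trans vu uz); rewrite leqNgt level_anc_lt //.
apply/eqP => zu; have /iter_parent_cycle zE : iter 1 parent z = z by rewrite /= pz zu.
by rewrite zE eqxx in zr.
Qed.

Lemma parent_closed_anc X u v : parent_closed X -> u \in X -> anc v u -> v \in X.
Proof.
move=> clX uX /iter_findex <-; elim: (findex _ _ _) => //= n; exact: clX.
Qed.

Lemma frontier_exists X v z : v \in X -> z \notin X -> anc v z ->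
  exists u, [/\ u \notin X, parent u \in X, anc v u & anc u z].
Proof.
move=> vX zX /iter_findex; move: (findex _ _ _) => n.
elim: n z zX => [|n IH] z zX; first by move=> /= zv; rewrite zv vX in zX.
rewrite iterSr => nE; case pX: (parent z \in X).
  exists z; split=> //; last exact: anc_refl.
  by rewrite -nE; apply: anc_trans (anc_parent z); apply: fconnect_iter.
have [u [uX puX vu uz]] := IH _ (negbT pX) nE.
by exists u; split=> //; apply: anc_trans uz (anc_parent z).
Qed.

(** A path inside [X] from [u] to the root can leave the vertices below [u] only through [parent u];
    were that vertex missing, the root would lie below [u]. *)
Lemma rooted_subtree_closed X : rooted_subtree X -> parent_closed X.
Proof.
move=> [rX conX] u uX; case: (boolP (parent u \in X)) => // puX.
have /connectP[p pth lastE] := conX _ _ uX rX.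
suff /anc_antisym/(_ (anc_root u)) uE : anc u root by rewrite uE parent_root rX in puX.
rewrite lastE; suff below x : path [rel x y | [&& x \in X, y \in X & adjacent x y]] x p ->
    anc u x -> anc u (last x p) by apply: below pth (anc_refl u).
elim: p x {pth lastE} => //= y p IH x /andP[/and3P[xX yX adj] pth] ux.
apply: IH pth _; case/orP: adj => /andP[nr /eqP pE].
  by apply: anc_trans ux _; rewrite -pE anc_parent.
have [xu|xu] := eqVneq x u; first by move: puX; rewrite -xu pE yX.
have /iter_findex := ux; case: (findex _ _ _) => [/= xuE|n].
  by rewrite xuE eqxx in xu.
by rewrite iterSr pE => <-; apply: fconnect_iter.
Qed.

Lemma closed_rooted_subtree X u : u \in X -> parent_closed X -> rooted_subtree X.
Proof.
move=> uX clX; have rX : root \in X := parent_closed_anc clX uX (anc_root u).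
split=> // {uX} {}u v uX vX.
set e := [rel x y | _].
have sym : connect_sym e.
  by apply: sym_connect_sym => x y; rewrite /e /= andbCA /adjacent orbC.
have toroot x : x \in X -> connect e x root.
  have /iter_findex := root_reachable x; move: (findex _ _ _) => n.
  elim: n x => [|n IH] x; first by move=> /= -> _; apply: connect0.
  rewrite iterSr => nE xX; have pX := clX _ xX.
  apply: connect_trans (IH _ nE pX).
  have [->|xr] := eqVneq x root; first by rewrite parent_root connect0.
  by apply: connect1; rewrite /e /= xX pX /adjacent /child xr eqxx orbT.
by apply: connect_trans (toroot u uX) _; rewrite sym; apply: toroot.
Qed.

End Tree.

(** * Feasible solutions and the optimum *)

Lemma exists_min_in d (K : orderType d) (I : eqType) (P : I -> Prop) (key : I -> K)
    (s : seq I) (x : I) : x \in s -> P x ->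
  exists y, [/\ y \in s, P y & {in s, forall z, P z -> (key y <= key z)%O}].
Proof.
elim: s x => // a s IH x xas Px.
have min_a : P a -> {in s, forall z, P z -> (key a <= key z)%O} ->
    exists y, [/\ y \in a :: s, P y & {in a :: s, forall z, P z -> (key y <= key z)%O}].
  move=> Pa amin; exists a; split=> //; first exact: mem_head.
  by move=> z; rewrite inE => /predU1P[-> //|]; apply: amin.
have [[z zs Pz]|none] := classic (exists2 z, z \in s & P z); last first.
  have xa : x = a.
    by move: xas; rewrite inE => /predU1P[//|xs]; case: none; exists x.
  by apply: min_a => [|z zs Pz]; [rewrite -xa | case: none; exists z].
have [y [ys Py ymin]] := IH z zs Pz.
have [[Pa lt_ay]|nota] := classic (P a /\ (key a < key y)%O).
  by apply: min_a => // u us Pu; apply: le_trans (ltW lt_ay) (ymin u us Pu).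
exists y; split=> //; first by rewrite inE ys orbT.
move=> u; rewrite inE => /predU1P[->|]; last exact: ymin.
by move=> Pa; rewrite leNgt; apply/negP => lt_ay; case: nota.
Qed.

Lemma exists_lower_bound (s : seq int) : exists m : int, all (fun x => m < x) s.
Proof.
elim: s => [|x s [m ms]]; first by exists 0.
exists (Num.min m (x - 1)) => /=; rewrite gt_min ltrBlDr ltrDl ltr01 orbT /=.
by apply: sub_all ms => y my; rewrite gt_min my.
Qed.

Lemma ler_sum_uniq_sub (R : realFieldType) (I : eqType) (F : I -> R) (s1 s2 : seq I) :
    (forall i, 0 <= F i) -> uniq s1 -> {subset s1 <= s2} ->
  \sum_(i <- s1) F i <= \sum_(i <- s2) F i.
Proof.
move=> F0; elim: s1 s2 => [|x s1 IH] s2 /=; first by rewrite big_nil sumr_ge0.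
case/andP=> xs1 us1 sub12.
have /perm_to_rem p : x \in s2 by rewrite sub12 ?mem_head.
rewrite (perm_big _ p) !big_cons lerD2l IH // => y ys1.
have: y \in s2 by rewrite sub12 // inE ys1 orbT.
rewrite (perm_mem p) inE => /predU1P[yx|//].
by rewrite -yx ys1 in xs1.
Qed.

Lemma exists_small_cover (I K : eqType) (P : I -> K -> Prop) (s : seq I) (r : seq K) :
    {in s, forall i, exists2 k, k \in r & P i k} ->
  exists r', [/\ uniq r', {subset r' <= r}, (size r' <= size s)%N
             & {in s, forall i, exists2 k, k \in r' & P i k}].
Proof.
elim: s => [|i s IH] cov; first by exists [::].
have [|r' [ur' sr' szr' cov']] := IH.
  by move=> j js; apply: cov; rewrite inE js orbT.
have [k kr Pik] := cov i (mem_head _ _).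
case: (boolP (k \in r')) => kr'.
  exists r'; split=> //; first exact: leqW.
  by move=> j; rewrite inE => /predU1P[->|/cov'//]; exists k.
exists (k :: r'); split=> //=; first by rewrite kr'.
  by move=> j; rewrite inE => /predU1P[->|/sr'].
move=> j; rewrite inE => /predU1P[->|/cov'[h hr' Pjh]]; first by exists k; rewrite ?mem_head.
by exists h => //; rewrite inE hr' orbT.
Qed.

Section Feasible.
Variables (R : realFieldType) (T : wtree R).
Implicit Types (J : seq (request T)) (S : seq (service T)).

Lemma feasibleP J S :
  feasible J S <-> solution S /\
    {in J, forall j : request T, exists2 s : service T, s \in S &
       location j \in transmitted s /\ arrival j <= time s <= deadline j}.
Proof.
split=> -[solS H]; split=> // j /H.
  by case=> t [_ [s sS [js <-]] _] tj; exists s.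
case=> s sS [js /andP[aj dj]].
have [s0 [s0S [js0 aj0] smin]] := @exists_min_in _ int _
  (fun s : service T => location j \in transmitted s /\ arrival j <= time s)
  (@time R T) S s sS (conj js aj).
exists (time s0); last by rewrite aj0 (le_trans (smin s sS _) dj).
by split=> // [|z zS jz az]; [exists s0 | apply: smin].
Qed.

Lemma set_weight_ge0 (X : {set T}) : 0 <= \sum_(v in X) weight v.
Proof. by apply: sumr_ge0 => v _; apply: weight_ge0. Qed.

(** One service per request suffices, and the cost depends only on the transmitted sets, so the
    minimum runs over the finite type of sequences of at most [size J] vertex sets. *)
Lemma OPT_exists J S : feasible J S -> exists OPT, is_OPT J OPT.
Proof.
move=> feasS.
pose B : finType := (size J).-bseq {set T}.
pose key (b : B) : R := \sum_(X <- b) \sum_(v in X) weight v.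
pose P (b : B) := exists2 S', feasible J S' & map (@transmitted R T) S' = b.
have keyE (b : B) S' : map (@transmitted R T) S' = b -> key b = cost S'.
  by rewrite /key => <-; rewrite big_map.
have small S' : feasible J S' -> exists2 b, P b & key b <= cost S'.
  case/feasibleP=> solS' /exists_small_cover[r [ur sr szr cov]].
  have szb : (size (map (@transmitted R T) r) <= size J)%N by rewrite size_map.
  exists (Bseq szb).
    by exists r => //; apply/feasibleP; split=> // s /sr; apply: solS'.
  by rewrite (keyE _ r) //; apply: ler_sum_uniq_sub => // s; apply: set_weight_ge0.
have [b Pb _] := small S feasS.
have [b0 [_ [S0 feasS0 mapS0] bmin]] :=
  @exists_min_in _ R _ P key _ b (mem_enum B b) Pb.
exists (cost S0); split=> [|S' /small[b' Pb' le_b']]; first by exists S0.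
by rewrite -(keyE b0) //; apply: le_trans (bmin _ _ Pb') le_b'; rewrite mem_enum.
Qed.

End Feasible.

(** * A single service *)

Record state (R : realFieldType) (T : wtree R) := State {
  sent : {set T};
  budget : T -> R;
  credit : T -> R
}.

Section Service.
Variables (R : realFieldType) (T : wtree R).
Implicit Types (Q : seq (request T)) (s : state T) (t : int) (u v : T).

Definition due Q t : {set T} :=
  [set v | has (fun j : request T => anc v (location j) && (deadline j == t)) Q].

(* [p.1] pays for [p.2] only if [p.2] leads to a most urgent request among those
   below [p.1] which the subtree built so far does not serve. *)
Definition payable Q s (p : T * T) : bool :=
  [&& p.1 \in sent s, 0 < budget s p.1, p.2 \notin sent s,
      parent p.2 \in sent s, anc p.1 p.2
    & has (fun j : request T => anc p.2 (location j) &&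
        all (fun k : request T => anc p.1 (location k) && (location k \notin sent s)
               ==> (deadline j <= deadline k)) Q) Q].

Definition pay s (p : T * T) : state T :=
  let a := Num.min (budget s p.1) (weight p.2 - credit s p.2) in
  State (if a == weight p.2 - credit s p.2 then p.2 |: sent s else sent s)
    (fun x => if x == p.1 then budget s x - a else budget s x)
    (fun x => if x == p.2 then credit s x + a else credit s x).

Definition step Q s : state T :=
  if [pick p | payable Q s p] is Some p then pay s p else s.

(* Every payment adds a vertex or exhausts a budget, so that nothing is payable
   any more after [2 * #|T|] steps. *)
Definition invest Q t (c : T -> R) : state T :=
  iter (2 * #|T|)%N (step Q) (State (due Q t) weight c).

Definition leftover s : T -> R := fun u => if u \in sent s then 0 else credit s u.

(** [online] compares request lists only up to permutation, so a service must not depend on their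
    order. *)
Lemma step_eq_mem Q Q' s : Q =i Q' -> step Q s = step Q' s.
Proof.
move=> eqQ; rewrite /step; suff /eq_pick-> : payable Q s =1 payable Q' s by [].
move=> p; rewrite /payable (eq_has_r eqQ); do 5!congr (_ && _).
by apply: eq_has => j; rewrite (eq_all_r eqQ).
Qed.

Lemma invest_eq_mem Q Q' t c : Q =i Q' -> invest Q t c = invest Q' t c.
Proof.
move=> eqQ; rewrite /invest; have -> : due Q t = due Q' t.
  by apply/setP => v; rewrite !inE (eq_has_r eqQ).
by elim: (2 * _)%N => //= n ->; apply: step_eq_mem.
Qed.

Definition active s : {set T} := [set v in sent s | 0 < budget s v].

(** A completed payment removes the payee from the missing vertices but may make it active, hence
    the factor 2. Any other payment exhausts the payer, which stops being active. *)
Lemma pay_measure Q s p : payable Q s p ->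
  (2 * #|~: sent (pay s p)| + #|active (pay s p)| < 2 * #|~: sent s| + #|active s|)%N.
Proof.
case: p => v u /and5P[/= vX b0 uX puX _]; rewrite /pay /=.
set a := Num.min _ _; case: eqP => [aE|aN].
  have -> : ~: (u |: sent s) = (~: sent s) :\ u.
    by apply/setP => x; rewrite !inE negb_or.
  have := cardsD1 u (~: sent s); rewrite inE uX /= => ->.
  set A' := active _; suff : (#|A'| <= 1 + #|active s|)%N by lia.
  apply: (@leq_trans #|u |: active s|); last first.
    by rewrite cardsU1; case: (u \notin _); lia.
  apply/subset_leq_card/subsetP => x; rewrite !inE /=.
  case: (x =P u) => //= _ /andP[-> /=]; case: (x =P v) => [-> //|//].
have {}aN : a = budget s v by move: aN; rewrite /a; case: leP.
rewrite ltn_add2l; apply/proper_card/properP; split.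
  apply/subsetP => x; rewrite !inE /= => /andP[-> /=].
  by case: (x =P v) => [-> //|//].
by exists v; rewrite !inE vX //= eqxx aN subrr ltxx.
Qed.

Lemma invest_final Q t c p : ~~ payable Q (invest Q t c) p.
Proof.
rewrite /invest; set s0 := State _ _ _.
have : (2 * #|~: sent s0| + #|active s0| <= 2 * #|T|)%N.
  have := cardsC (sent s0); have : (#|active s0| <= #|sent s0|)%N.
    by apply/subset_leq_card/subsetP => x; rewrite inE => /andP[].
  by rewrite -cardsT; lia.
elim: (2 * _)%N s0 => [|n IH] s0 len.
  by apply/negP => /pay_measure; rewrite ltnNge (leq_trans len).
rewrite iterSr; case: (pickP (payable Q s0)) => [q qp|nop].
  apply: IH; rewrite /step; case: pickP => [q' q'p|/(_ q)]; last by rewrite qp.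
  by have := pay_measure q'p; lia.
have fix0 : step Q s0 = s0 by rewrite /step; case: pickP => // q; rewrite nop.
by rewrite fix0; elim: n {IH len} => [|n IH]; rewrite ?nop // iterSr fix0.
Qed.

(** Used in contrapositive form: once nothing is payable, a transmitted vertex with budget left has
    no unserved request below it. The payee is a missing vertex with transmitted parent on the path
    to a most urgent such request. *)
Lemma payable_exists Q s v (j : request T) :
    parent_closed (sent s) -> v \in sent s -> 0 < budget s v -> j \in Q ->
    anc v (location j) -> location j \notin sent s ->
  exists u, payable Q s (v, u).
Proof.
move=> clX vX b0 jQ vj jX.
have [k [kQ /andP[vk kX] kmin]] := @exists_min_in _ int _
  (fun k : request T => anc v (location k) && (location k \notin sent s))
  (@deadline R T) Q j jQ (introT andP (conj vj jX)).
have [u [uX puX vu uk]] := frontier_exists vX kX vk.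
exists u; rewrite /payable /= vX b0 uX puX vu /=; apply/hasP; exists k; rewrite // uk /=.
by apply/allP => i iQ; apply/implyP; apply: kmin.
Qed.

(** * The potential argument for one service *)

Section Potential.
Variables (Q : seq (request T)) (t : int) (late : T -> int -> bool).
Hypothesis late_anc : forall v u d, anc v u -> late v d -> late u d.
Hypothesis late_le : forall v d e, d <= e -> late v e -> late v d.
Hypothesis late_now : forall v, late v t.

(* [late v d] stands for: the reference solution does not transmit v from now on
   until time d. *)
Definition overdue_outside (X : {set T}) v : bool :=
  has (fun j : request T => [&& anc v (location j), location j \notin X
                              & late v (deadline j)]) Q.

Local Notation D := ((depth T)%:R : R).
Local Notation lev v := ((level v)%:R : R).

Definition credit_value (od : T -> bool) v : R := lev v - 1 - (if od v then 0 else D).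
(** Value of a unit spent by [v]: one more than a unit of credit on [v]. A payee lies at least one
    level deeper, which makes up for the difference. *)
Definition investor_value (od : T -> bool) v : R := lev v - (if od v then 0 else D).
Local Notation od0 := (overdue_outside set0).

(** By [inv_potential], the value of what was spent is covered by the value of the credit it
    created. Spending is valued by the requests still unserved, credit by all those in [Q]. *)
Record service_invariant (c0 : T -> R) s : Prop := ServiceInvariant {
  inv_closed : parent_closed (sent s);
  inv_due : due Q t \subset sent s;
  inv_budget : forall v, 0 <= budget s v <= weight v;
  inv_credit : forall v, 0 <= credit s v <= weight v;
  inv_paid : forall v, v \in sent s -> v \notin due Q t -> credit s v = weight v;
  inv_unsent : forall v, v \notin sent s -> budget s v = weight v;
  inv_potential :
    \sum_v investor_value (overdue_outside (sent s)) v * (weight v - budget s v) <=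
    \sum_v credit_value od0 v * (credit s v - c0 v) }.

Lemma overdue_outsideW (X Y : {set T}) v : X \subset Y ->
  overdue_outside Y v -> overdue_outside X v.
Proof.
move=> /subsetP sXY /hasP[j jQ /and3P[vj jY lj]].
by apply/hasP; exists j; rewrite // vj lj (contra (sXY _) jY).
Qed.

Lemma investor_valueW (X Y : {set T}) v : X \subset Y ->
  investor_value (overdue_outside Y) v <= investor_value (overdue_outside X) v.
Proof.
move=> sXY; rewrite /investor_value.
have := @overdue_outsideW _ _ v sXY.
case: (overdue_outside Y v); first by move=> ->.
by have : 0 <= D by []; case: (overdue_outside X v); lra.
Qed.

(* If the payer still has overdue requests below it, then so does the payee,
   because it leads to a more urgent request. *)
Lemma payable_value s v u : payable Q s (v, u) ->
  investor_value (overdue_outside (sent s)) v <= credit_value od0 u.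
Proof.
case/and5P => /= vX b0 uX puX /andP[vu /hasP[j jQ /andP[uj /allP jmin]]].
have lt_vu : lev v + 1 <= lev u.
  rewrite natr1 ler_nat level_anc_lt //.
  by apply: contraNneq uX => ->.
have D0 : 0 <= D by [].
rewrite /investor_value /credit_value.
case: ifP => [/hasP[k kQ /and3P[vk kX lk]]|_]; last by case: ifP => _; lra.
suff -> : od0 u by lra.
apply/hasP; exists j; rewrite // uj inE /=.
apply: late_anc vu (late_le _ lk).
by have /implyP := jmin k kQ; apply; rewrite vk.
Qed.

Lemma sum_upd (F G : T -> R) v a : (forall x, F x - G x = if x == v then a else 0) ->
  \sum_x F x = \sum_x G x + a.
Proof.
move=> FG; have -> : a = \sum_(x : T) (if x == v then a else 0).
  by rewrite -big_mkcond big_pred1_eq.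
by rewrite -big_split; apply: eq_bigr => x _; rewrite -FG /= subrKC.
Qed.

Lemma pay_invariant c0 s p :
  payable Q s p -> service_invariant c0 s -> service_invariant c0 (pay s p).
Proof.
case: p => v u pvu [cl sdue bud cre paid unsent pot].
have val := payable_value pvu.
move/and5P: pvu => /= [vX b0 uX puX /andP[vu _]].
have sub : sent s \subset sent (pay s (v, u)).
  by rewrite /pay /=; case: ifP => // _; apply: subsetUr.
have uv : u == v = false by apply: contraNF uX => /eqP->.
have a0 : 0 <= Num.min (budget s v) (weight u - credit s u).
  by rewrite le_min ltW // subr_ge0; case/andP: (cre u).
split.
- rewrite /pay /=; case: ifP => _ // x; rewrite !inE => /predU1P[->|/cl->].
    by rewrite puX orbT.
  by rewrite orbT.
- exact: subset_trans sdue sub.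
- move=> x; rewrite /pay /=; case: (x =P v) => [->|_ //].
  have /andP[_ bw] := bud v.
  by rewrite subr_ge0 ge_min lexx /= (le_trans _ bw) // gerBl.
- move=> x; rewrite /pay /=; case: (x =P u) => [->|_ //].
  have /andP[c0u cw] := cre u.
  by rewrite addr_ge0 //= -lerBrDl ge_min lexx orbT.
- move=> x; rewrite /pay /=; case: eqP => [aE|_] xX xd; last first.
    case: (x =P u) => [xu|_]; last exact: paid.
    by rewrite xu (negbTE uX) in xX.
  case: (x =P u) xX => [->|/eqP xu]; first by rewrite aE subrKC.
  by rewrite !inE (negbTE xu) /= => xX; apply: paid.
- move=> x xX; have xs : x \notin sent s by apply: contra xX => /(subsetP sub).
  rewrite /pay /=; case: (x =P v) => [xv|_]; last exact: unsent.
  by rewrite xv vX in xs.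
set X' := sent _ in sub *.
rewrite /pay /=; set a := Num.min _ _ in a0 *.
(* The payment adds [credit_value od0 u * a] on the right and a smaller or equal amount on the left,
   by [val]; enlarging the sent set only lowers investor values. *)
rewrite (@sum_upd (fun x => credit_value od0 x * _)
  (fun x => credit_value od0 x * (credit s x - c0 x)) u (credit_value od0 u * a)); last first.
  by move=> x; case: eqP => [->|_]; ring.
apply: (@le_trans _ _ (\sum_x investor_value (overdue_outside (sent s)) x * (weight x - budget s x)
   + investor_value (overdue_outside (sent s)) v * a)); last first.
  by apply: lerD => //; apply: ler_wpM2r.
rewrite -(@sum_upd (fun x => investor_value (overdue_outside (sent s)) x
   * (weight x - (if x == v then budget s x - a else budget s x))) _ v); last first.
  by move=> x; case: eqP => [->|_]; ring.
apply: ler_sum => x _; apply: ler_wpM2r; last exact: investor_valueW.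
have /andP[_] := bud x; case: ifP => _; lra.
Qed.

Lemma invest_invariant c : (forall v, 0 <= c v <= weight v) -> service_invariant c (invest Q t c).
Proof.
move=> cw; rewrite /invest; elim: (2 * _)%N => [|n IH]; last first.
  rewrite iterS; set s := iter _ _ _ in IH *; rewrite /step.
  by case: pickP => // p pp; apply: pay_invariant.
split=> //=.
- move=> v; rewrite !inE => /hasP[j jQ /andP[vj dj]].
  by apply/hasP; exists j; rewrite // dj andbT (anc_trans (anc_parent v)).
- by move=> v; rewrite weight_ge0 lexx.
- by move=> v ->.
- by rewrite !big1 // => v _; rewrite subrr mulr0.
Qed.

Lemma due_overdue v : v \in due Q t -> od0 v.
Proof.
rewrite inE => /hasP[j jQ /andP[vj /eqP dj]].
by apply/hasP; exists j; rewrite // vj inE dj late_now.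
Qed.

(** Adding [inv_potential] splits the claim into one inequality per vertex; the fall in overdue
    weight comes from the critical transmissions. *)
Lemma invest_potential c (s := invest Q t c) (od1 := overdue_outside (sent s)) :
    (forall v, 0 <= c v <= weight v) ->
  \sum_(v in sent s) weight v <=
    D * (\sum_(v | od0 v) weight v - \sum_(v | od1 v) weight v)
    + (\sum_v credit_value od1 v * leftover s v - \sum_v credit_value od0 v * c v).
Proof.
move=> cw; have [cl sdue bud cre paid unsent pot] := invest_invariant cw.
rewrite -/s -/od1 in cl sdue bud cre paid unsent pot.
have : \sum_(v in sent s) weight v <= \sum_v (D * ((if od0 v then weight v else 0)
    - (if od1 v then weight v else 0)) + credit_value od1 v * leftover s v
    - credit_value od0 v * credit s v
    + investor_value od1 v * (weight v - budget s v)).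
  rewrite big_mkcond; apply: ler_sum => v _.
  have od10 : od1 v -> od0 v by apply: overdue_outsideW; apply: sub0set.
  have /andP[b0 bw] := bud v; have /andP[c0 cwv] := cre v.
  have l1 : 1 <= lev v by rewrite ler1n level_gt0.
  have lD : lev v <= D by rewrite ler_nat level_le_depth.
  rewrite /credit_value /investor_value /leftover.
  case: ifP => vX; last first.
    (* [v] is not sent, so by closure under [parent] no request below it is served, and its status
       does not change. *)
    have -> : od1 v = od0 v.
      apply/idP/idP => [//|/hasP[j jQ /and3P[vj _ lj]]].
      apply/hasP; exists j; rewrite // vj lj andbT /=.
      by apply: contraFN vX => jX; apply: parent_closed_anc vj.
    by rewrite (unsent v) ?vX //; case: ifP => _; lra.
  case: (boolP (od1 v)) => [odv|nod1].
    (* Pending: with budget left, [v] could still pay towards an unserved request, against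
       [invest_final]. *)
    rewrite (od10 odv); suff -> : budget s v = 0 by nra.
    apply/eqP; rewrite eq_le b0 andbT leNgt; apply/negP => bpos.
    case/hasP: odv => j jQ /and3P[vj jX _].
    have [u] := payable_exists cl vX bpos jQ vj jX.
    by apply/negP/invest_final.
  (* A critical transmission uses the term [D * weight v]; an early one is not due, hence was paid
     in full. *)
  case: (boolP (od0 v)) => [_|nod0]; first by nra.
  rewrite (paid v) //; first by nra.
  by apply: contra nod0; apply: due_overdue.
rewrite big_split /= big_split /= big_split /= -mulr_sumr sumrB -!big_mkcond /= sumrN.
have : \sum_v credit_value od0 v * (credit s v - c v) =
  \sum_v credit_value od0 v * credit s v - \sum_v credit_value od0 v * c v.
  by rewrite -sumrB; apply: eq_bigr => v _; rewrite mulrBr.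
by lra.
Qed.

End Potential.
End Service.

(** * The online algorithm *)

Section Run.
Variables (R : realFieldType) (T : wtree R).
Implicit Types (J : seq (request T)) (S past : seq (service T)) (t : int) (v : T).

Definition pending J past t : seq (request T) :=
  [seq j : request T <- J | (arrival j <= t) && ~~ has (fun s : service T =>
     (location j \in transmitted s) && (arrival j <= time s)) past].

Fixpoint run J (ts : seq int) past (c : T -> R) : seq (service T) :=
  if ts is t :: ts' then
    let Q := pending J past t in
    let s := invest Q t c in
    if due Q t == set0 then run J ts' past c
    else (sent s, t) :: run J ts' ((sent s, t) :: past) (leftover s)
  else [::].

Definition times J : seq int := sort <=%O (undup (map (@deadline R T) J)).

Definition aggregate J : seq (service T) := run J (times J) [::] (fun _ => 0).

Lemma mem_times J t : (t \in times J) = has (fun j : request T => deadline j == t) J.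
Proof.
rewrite mem_sort mem_undup; apply/mapP/hasP => [[j jJ ->]|[j jJ /eqP<-]]; exists j => //.
Qed.

Lemma times_sorted J : sorted <%O (times J).
Proof. by rewrite lt_sorted_uniq_le sort_uniq undup_uniq sort_sorted //; apply: le_total. Qed.

(** * Causality of the run *)

Lemma time_run J ts past c : {in run J ts past c, forall s, time s \in ts}.
Proof.
elim: ts past c => //= t ts IH past c s; case: ifP => _.
  by move/IH; rewrite inE orbC => ->.
by rewrite !inE => /predU1P[->|/IH->]; rewrite ?eqxx ?orbT.
Qed.

Lemma services_until_run J ts past c t0 : sorted <%O ts ->
  services_until t0 (run J ts past c) = run J [seq t <- ts | t <= t0] past c.
Proof.
elim: ts past c => //= t ts IH past c pth.
have srt := path_sorted pth.
case: leP => [tt0|t0t] /=.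
  by case: ifP => _; rewrite ?IH //= /services_until /= tt0 -IH.
have gt_t0 u : u \in ts -> t0 < u.
  by move=> uts; apply: lt_trans t0t _; move/(order_path_min lt_trans)/allP: pth; apply.
rewrite -[RHS]IH //.
have nil past' c' : services_until t0 (run J ts past' c') = [::].
  apply/eqP; rewrite -(negbK (_ == _)) -has_filter; apply/negP => /hasP[s /time_run/gt_t0].
  by rewrite ltNge => /negP.
case: ifP => _ //; rewrite nil /services_until /= leNgt t0t /=; exact: nil.
Qed.

Lemma run_eq J J' ts past c :
    {in ts, forall t, arrived_by t J =i arrived_by t J'} ->
  run J ts past c = run J' ts past c.
Proof.
elim: ts past c => //= t ts IH past c eqJ.
have eqQ : pending J past t =i pending J' past t.
  move=> j; have := eqJ t (mem_head _ _) j; rewrite !mem_filter.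
  by case: (arrival j <= t) => //= ->.
have IH' past' c' : run J ts past' c' = run J' ts past' c'.
  by apply: IH => u uts; apply: eqJ; rewrite inE uts orbT.
have -> : due (pending J past t) t = due (pending J' past t) t.
  by apply/setP => v; rewrite !inE (eq_has_r eqQ).
by rewrite (invest_eq_mem t c eqQ) !IH'.
Qed.

(** Although [times J] contains future deadlines, those up to [t] belong to requests that have
    arrived by [t], since no deadline precedes its arrival. *)
Lemma aggregate_online J J' t : request_set J -> request_set J' ->
    perm_eq (arrived_by t J) (arrived_by t J') ->
  services_until t (aggregate J) = services_until t (aggregate J').
Proof.
move=> rJ rJ' /perm_mem eqJ; rewrite /aggregate !services_until_run ?times_sorted //.
have -> : [seq u <- times J | u <= t] = [seq u <- times J' | u <= t].
  apply: lt_sorted_eq; rewrite ?(sorted_filter lt_trans) ?times_sorted // => u.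
  rewrite !mem_filter; case: leP => //= ut; rewrite !mem_times.
  have sub K K' : request_set K -> {subset arrived_by t K <= arrived_by t K'} ->
      has (fun j : request T => deadline j == u) K ->
      has (fun j : request T => deadline j == u) K'.
    move=> rK sKK' /hasP[j jK /eqP dj]; have := sKK' j; rewrite !mem_filter jK andbT.
    rewrite (le_trans (rK j jK)) ?dj // => /(_ isT) jK'.
    by apply/hasP; exists j; rewrite ?dj.
  by apply/idP/idP; apply: sub => // j; rewrite eqJ.
apply: run_eq => u; rewrite mem_filter => /andP[ut _] j; have := eqJ j.
rewrite !mem_filter; case: (leP (arrival j) u) => //= au.
by rewrite (le_trans au ut).
Qed.

(** * Feasibility of the run *)

Lemma leftover_bound (s : state T) : (forall v, 0 <= credit s v <= weight v) ->
  forall v, 0 <= leftover s v <= weight v.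
Proof. by move=> cs v; rewrite /leftover; case: ifP => // _; rewrite lexx weight_ge0. Qed.

(* The lateness predicate is irrelevant to the clauses used through this instance. *)
Lemma invest_sound (Q : seq (request T)) t (c : T -> R) :
    (forall v, 0 <= c v <= weight v) ->
  service_invariant Q t (fun _ _ => false) c (invest Q t c).
Proof. by move=> cw; apply: invest_invariant. Qed.

Lemma run_solution J ts past c : (forall v, 0 <= c v <= weight v) ->
  solution (run J ts past c).
Proof.
elim: ts past c => //= t ts IH past c cw; have inv := invest_sound (pending J past t) t cw.
case: ifP => [_|/negbT/set0Pn[v vX] s]; first exact: IH.
rewrite inE => /predU1P[->|].
  apply: closed_rooted_subtree (inv_closed inv).
  exact: subsetP (inv_due inv) _ vX.
by apply: IH => //; apply: leftover_bound (inv_credit inv).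
Qed.

(** When the deadline of [j] comes, either an earlier service has served it or its location is due
    and therefore sent. *)
Lemma run_serves J ts past c (j : request T) : (forall v, 0 <= c v <= weight v) ->
    sorted <%O ts -> j \in J -> arrival j <= deadline j -> deadline j \in ts ->
    ~~ has (fun s : service T => (location j \in transmitted s) && (arrival j <= time s)) past ->
  exists2 s : service T, s \in run J ts past c &
    location j \in transmitted s /\ arrival j <= time s <= deadline j.
Proof.
move=> cw srt jJ aj dts nserved.
elim: ts past c cw srt dts nserved => //= t ts IH past c cw pth.
have srt := path_sorted pth.
have inv := invest_sound (pending J past t) t cw.
rewrite inE => /predU1P[dt|dts] nserved.
  have jX : location j \in due (pending J past t) t.
    rewrite inE; apply/hasP; exists j; last by rewrite anc_refl dt eqxx.
    by rewrite mem_filter -dt aj nserved.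
  have -> : (due (pending J past t) t == set0) = false.
    by apply/negbTE/set0Pn; exists (location j).
  exists (sent (invest (pending J past t) t c), t); first exact: mem_head.
  by split; [apply: subsetP (inv_due inv) _ jX | rewrite /time /= -dt aj lexx].
case: ifP => _; first exact: IH.
set s := invest _ _ _ in inv *.
case: (boolP ((location j \in sent s) && (arrival j <= t))) => [/andP[js at_]|nj].
  exists (sent s, t); first exact: mem_head.
  split=> //; rewrite /time /= at_ ltW //.
  by move/(order_path_min lt_trans)/allP: pth; apply.
have [|s' s'run s'P] :=
    IH ((sent s, t) :: past) (leftover s) (leftover_bound (inv_credit inv)) srt dts.
  by rewrite /= negb_or nj.
by exists s' => //; rewrite inE s'run orbT.
Qed.

Lemma aggregate_feasible J : request_set J -> feasible J (aggregate J).
Proof.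
move=> rJ; have cw (v : T) : 0 <= (0 : R) <= weight v by rewrite lexx weight_ge0.
apply/feasibleP; split; first exact: run_solution.
move=> j jJ; apply: run_serves; rewrite ?times_sorted ?rJ ?mem_times //.
by apply/hasP; exists j.
Qed.

(** * Comparison with a feasible solution *)

Section Competitive.
Variables (J : seq (request T)) (S : seq (service T)).
Hypothesis feasS : feasible J S.

(** A transmission by [S] at [t] itself counts as past, so a request due at [t] is always late;
    [opt_cost_after] follows the same convention. *)
Definition late t v d : bool :=
  ~~ has (fun s : service T => (v \in transmitted s) && (t < time s <= d)) S.

Definition overdue past t v : bool := overdue_outside (pending J past t) (late t) set0 v.

Local Notation D := ((depth T)%:R : R).

Lemma late_anc t v u d : anc v u -> late t v d -> late t u d.
Proof.
move=> vu; apply: contra => /hasP[s sS /andP[us ts]]; apply/hasP; exists s; rewrite // ts andbT.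
by case: feasS => solS _; apply: parent_closed_anc vu => //; apply/rooted_subtree_closed/solS.
Qed.

Lemma late_le t v d e : d <= e -> late t v e -> late t v d.
Proof.
move=> de; apply: contra => /hasP[s sS /and3P[vs ts sd]].
by apply/hasP; exists s; rewrite // vs ts (le_trans sd).
Qed.

Lemma late_now t v : late t v t.
Proof. by apply/hasPn => s _; apply/negP => /and3P[_ ts]; rewrite leNgt ts. Qed.

(** The status after a service is the one with which the next phase starts, so the bounds for
    successive services telescope. *)
Lemma overdue_service X past t v :
  overdue_outside (pending J past t) (late t) X v = overdue ((X, t) :: past) t v.
Proof.
rewrite /overdue /overdue_outside /pending !has_filter -!filter_predI.
rewrite -!has_filter; apply: eq_has => j /=; rewrite inE /time /transmitted /= negb_or.
by case: (arrival j <= t); rewrite /= ?andbF // andbT; case: (_ \in X); rewrite /= ?andbF.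
Qed.

Lemma overdue_persists past t0 t v : t0 <= t -> overdue past t0 v -> overdue past t v.
Proof.
move=> le_t0t /hasP[j]; rewrite mem_filter => /andP[/andP[aj nj] jJ] /and3P[vj _ lj].
apply/hasP; exists j; first by rewrite mem_filter (le_trans aj) // nj.
rewrite vj inE /=; apply: contra lj => /hasP[s sS /and3P[vs ts sd]].
by apply/hasP; exists s; rewrite // vs sd (le_lt_trans le_t0t).
Qed.

(* A request that arrived after [t0] and is late at [t] was served in between by S. *)
Lemma overdue_origin past t0 t v : overdue past t v ->
  overdue past t0 v \/ exists2 s : service T, s \in S & (v \in transmitted s) && (t0 < time s <= t).
Proof.
move=> /hasP[j]; rewrite mem_filter => /andP[/andP[aj nj] jJ] /and3P[vj _ lj].
have [[s sS Hs]|none] :=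
  classic (exists2 s : service T, s \in S & (v \in transmitted s) && (t0 < time s <= t)).
  by right; exists s.
left; case/feasibleP: (feasS) => solS /(_ j jJ)[s sS [js /andP[as_ sd]]].
have vs : v \in transmitted s.
  by apply: parent_closed_anc vj => //; apply/rooted_subtree_closed/solS.
apply/hasP; exists j; last first.
  rewrite vj inE /=; apply/hasPn => s' s'S; apply/negP => /and3P[vs' t0s' s'd].
  case: (leP (time s') t) => [s't|ts']; first by case: none; exists s'; rewrite // vs' t0s'.
  by case/negP: lj; apply/hasP; exists s'; rewrite // vs' ts'.
rewrite mem_filter nj jJ !andbT leNgt; apply/negP => t0a.
case: (leP (time s) t) => [st|ts].
  by case: none; exists s; rewrite // vs st (lt_le_trans t0a).
by case/negP: lj; apply/hasP; exists s; rewrite // vs ts.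
Qed.

Definition opt_cost_after t : R :=
  \sum_(s <- S | t < time s) \sum_(v in transmitted s) weight v.

(** By [overdue_origin], a vertex that becomes overdue with [past] unchanged was transmitted by [S]
    in between, and that transmission leaves [opt_cost_after]. *)
Lemma overdue_weight past t0 t : t0 <= t ->
  \sum_(v | overdue past t v) weight v + opt_cost_after t <=
  \sum_(v | overdue past t0 v) weight v + opt_cost_after t0.
Proof.
move=> le_t0t; rewrite /opt_cost_after.
rewrite [X in _ <= _ + X](bigID (fun s : service T => t < time s)) /=.
have -> : \sum_(s <- S | (t0 < time s) && (t < time s)) \sum_(v in transmitted s) weight v
   = \sum_(s <- S | t < time s) \sum_(v in transmitted s) weight v.
  by apply: eq_bigl => s; case: (ltP t) => [ts|_]; rewrite ?andbF // (le_lt_trans le_t0t).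
rewrite [X in _ <= _ + X]addrC addrA lerD2r.
under [X in _ <= _ + X]eq_bigr => s _ do rewrite big_mkcond.
rewrite exchange_big /= [X in X <= _]big_mkcond [X in _ <= X + _]big_mkcond -big_split /=.
apply: ler_sum => v _.
have sum0 r : 0 <= \sum_(s <- r | (t0 < time s) && ~~ (t < time s))
    (if v \in transmitted s then weight v else 0).
  by apply: sumr_ge0 => s _; case: ifP => // _; apply: weight_ge0.
case: ifP => [/(overdue_origin t0)[->|[s sS /and3P[vs t0s st]]]|_].
- by rewrite lerDl.
- apply: ler_wpDl; first by case: ifP => // _; apply: weight_ge0.
  by rewrite (perm_big _ (perm_to_rem sS)) big_cons t0s -leNgt st vs /= lerDl.
- by apply: addr_ge0 => //; case: ifP => // _; apply: weight_ge0.
Qed.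

Lemma credit_valueW (od od' : T -> bool) c : (forall v, od v -> od' v) ->
    (forall v, 0 <= c v) ->
  \sum_v credit_value od v * c v <= \sum_v credit_value od' v * c v.
Proof.
move=> sub c0; apply: ler_sum => v _; apply: ler_wpM2r => //.
have D0 : 0 <= D by []; have := sub v; rewrite /credit_value.
by case: (od v) => [->//|_]; case: (od' v); lra.
Qed.

(** The right-hand side is the potential. It does not increase between services, by [overdue_weight]
    and [credit_valueW], and a service lowers it by at least its cost, by [invest_potential]. *)
Lemma run_cost ts past c t0 : (forall v, 0 <= c v <= weight v) -> path <%O t0 ts ->
  cost (run J ts past c) <=
    D * (\sum_(v | overdue past t0 v) weight v + opt_cost_after t0)
    - \sum_v credit_value (overdue past t0) v * c v.
Proof.
have D0 : 0 <= D by [].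
elim: ts past c t0 => [|t ts IH] past c t0 cw /=.
  (* With no times left, the potential must be nonnegative: credits are at most weights, and levels
     lie between 1 and [D]. *)
  move=> _; rewrite /cost big_nil mulrDr subr_ge0.
  apply: ler_wpDr.
    by apply: mulr_ge0 => //; apply: sumr_ge0 => s _; apply: set_weight_ge0.
  rewrite [X in _ <= _ * X]big_mkcond mulr_sumr; apply: ler_sum => v _.
  have /andP[c0 cv] := cw v; have := level_le_depth v; rewrite -(ler_nat R) => lD.
  have := level_gt0 v; rewrite -(ler_nat R) => l1.
  by rewrite /credit_value; case: ifP => _; nra.
case/andP=> lt_t0t pth; have le_t0t := ltW lt_t0t.
have c0 v : 0 <= c v by case/andP: (cw v).
have wt := overdue_weight past le_t0t.
have cr : \sum_v credit_value (overdue past t0) v * c v <=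
    \sum_v credit_value (overdue past t) v * c v.
  by apply: credit_valueW => // v; apply: overdue_persists.
case: ifP => _.
  have := IH past c t cw pth; have := ler_wpM2l D0 wt; lra.
have inv := invest_sound (pending J past t) t cw.
have := invest_potential (pending J past t) (late_anc (t := t)) (late_le (t := t)) (late_now t) cw.
set s := invest _ _ _ in inv *.
have eq_od v : overdue_outside (pending J past t) (late t) (sent s) v
    = overdue ((sent s, t) :: past) t v by apply: overdue_service.
rewrite (eq_bigl _ _ eq_od) -/(overdue past t).
have -> :
    \sum_v credit_value (overdue_outside (pending J past t) (late t) (sent s)) v * leftover s v
    = \sum_v credit_value (overdue ((sent s, t) :: past) t) v * leftover s v.
  by apply: eq_bigr => v _; rewrite /credit_value eq_od.
have := IH ((sent s, t) :: past) (leftover s) t (leftover_bound (inv_credit inv)) pth.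
rewrite /cost big_cons /=; have := ler_wpM2l D0 wt.
lra.
Qed.

Lemma aggregate_cost : request_set J -> cost (aggregate J) <= D * cost S.
Proof.
move=> rJ; have cw (v : T) : 0 <= (0 : R) <= weight v by rewrite lexx weight_ge0.
(* Before all arrivals nothing is pending, so no vertex is overdue; the initial credit is zero as
   well. *)
have [m mJ] := exists_lower_bound (map (@arrival R T) J).
have ltm j : j \in J -> m < arrival j by move=> jJ; apply: (allP mJ); apply: map_f.
have pth : path <%O m (times J).
  rewrite path_min_sorted ?times_sorted //; apply/allP => t.
  rewrite mem_times => /hasP[j jJ /eqP<-].
  exact: lt_le_trans (ltm j jJ) (rJ j jJ).
have := run_cost [::] cw pth; rewrite -/(aggregate J) => /le_trans; apply.
rewrite [X in _ - X]big1 ?subr0 => [|v _]; last by rewrite mulr0.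
apply: ler_wpM2l => //; rewrite big1 ?add0r => [|v /hasP[j]]; last first.
  by rewrite mem_filter => /andP[/andP[]]; rewrite leNgt => /negP nm _ /ltm.
rewrite /opt_cost_after /cost [X in X <= _]big_mkcond.
by apply: ler_sum => s _; case: ifP => // _; apply: set_weight_ge0.
Qed.

End Competitive.
End Run.

Theorem theorem1 (R : realFieldType) :
  exists2 A : algorithm R, online A &
    forall (T : wtree R) (J : seq (request T)), request_set J ->
      feasible J (A T J) /\
      exists2 OPT : R, is_OPT J OPT & cost (A T J) <= (depth T)%:R * OPT.
Proof.
exists (@aggregate R) => [T J J' t|T J rJ]; first exact: aggregate_online.
have feas := aggregate_feasible rJ; split=> //.
have [OPT optJ] := OPT_exists feas; exists OPT => //.
by case: optJ => -[S feasS <-] _; apply: aggregate_cost.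
Qed.
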